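(* Let $d\ge 1$, let $\lambda\in[-1,1/d)$, let $I\subset\mathbb{R}$ be an interval and let $\gamma:I\to\mathbb{R}^d$ be a continuous $\lambda$-curve. Then $\gamma$ is rectifiable. In particular, if moreover $\gamma(I)$ is bounded, then $\gamma$ has finite length.
   Context: $\mathbb{R}^d$ carries the Euclidean norm $\|\cdot\|$ and distance $d(x,y)=\|x-y\|$. For $\lambda\in[-1,1)$, a curve $\gamma:I\to\mathbb{R}^d$ ($I$ an interval) is a $\lambda$-curve if for all $t_1\le t_2\le t_3$ in $I$: $d(\gamma(t_1),\gamma(t_2))\le d(\gamma(t_1),\gamma(t_3))+\lambda\, d(\gamma(t_2),\gamma(t_3))$. The length of $\gamma$ is $\ell(\gamma)=\sup\sum_{i=0}^{m-1}\|\gamma(t_i)-\gamma(t_{i+1})\|$, the supremum over all finite increasing sequences $t_0<\dots<t_m$ in $I$; $\gamma$ is rectifiable if its length is locally finite (finite on every compact subinterval of $I$). *)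

(* Defs.v *)
(* R : realType, R^d = 'rV[R]_d with the EUCLIDEAN norm
   (defined explicitly, since MathComp's canonical norm on matrices is the sup norm). *)
From HB Require Import structures.
From mathcomp Require Import all_boot all_order all_algebra.
From mathcomp Require Import all_classical all_reals all_analysis.
Set Implicit Arguments. Unset Strict Implicit. Unset Printing Implicit Defensive.
Import Order.TTheory GRing.Theory Num.Theory.
Local Open Scope classical_set_scope.
Local Open Scope ring_scope.

Definition enorm {R : realType} {d : nat} (v : 'rV[R]_d) : R :=
  Num.sqrt (\sum_(i < d) (v ord0 i) ^+ 2).

Definition edist {R : realType} {d : nat} (x y : 'rV[R]_d) : R := enorm (x - y).

Definition lambda_curve {R : realType} {d : nat} (lam : R) (I : set R)
    (gamma : R -> 'rV[R]_d) : Prop :=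
  forall t1 t2 t3, I t1 -> I t2 -> I t3 -> t1 <= t2 -> t2 <= t3 ->
    edist (gamma t1) (gamma t2) <=
      edist (gamma t1) (gamma t3) + lam * edist (gamma t2) (gamma t3).

Definition continuous_on_E {R : realType} {d : nat} (I : set R)
    (gamma : R -> 'rV[R]_d) : Prop :=
  forall t, I t -> forall e : R, 0 < e -> exists2 del : R, 0 < del &
    forall s, I s -> `|s - t| < del -> edist (gamma s) (gamma t) < e.

Definition poly_sums {R : realType} {d : nat} (I : set R)
    (gamma : R -> 'rV[R]_d) : set (\bar R) :=
  [set x | exists (m : nat) (t : nat -> R),
     (forall i, (i <= m)%N -> I (t i)) /\
     (forall i, (i < m)%N -> t i < t i.+1) /\
     x = ((\sum_(i < m) edist (gamma (t i)) (gamma (t i.+1)))%:E)%E].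

Definition curve_length {R : realType} {d : nat} (I : set R)
    (gamma : R -> 'rV[R]_d) : \bar R := ereal_sup (poly_sums I gamma).

Definition rectifiable {R : realType} {d : nat} (I : set R)
    (gamma : R -> 'rV[R]_d) : Prop :=
  forall a b, I a -> I b ->
    (curve_length [set t | I t /\ (a <= t <= b)%R] gamma < +oo)%E.

Definition bounded_image {R : realType} {d : nat} (I : set R)
    (gamma : R -> 'rV[R]_d) : Prop :=
  exists M : R, forall t, I t -> enorm (gamma t) <= M.

(* Main.v *)
(** Let [z] be a point of the curve.  The defining inequality forces any two unit vectors pointing from
    earlier points to [z] to have inner product at least [- lam].  As [lam < 1/d], all these unit vectors
    lie uniformly inside a half-space: some [w] has inner product at least a constant [eta d lam > 0]
    with each of them, and up to halving the constant, [w] may be taken in a fixed finite grid.  Moreover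
    all points before a point [y], itself before [z], have distance at least [(1 - lam) / 2 * |z - y|]
    to [z].  Hence the running maximum of the linear form [w] grows by at least a constant times [|z - y|]
    between [y] and [z], while the sum of the running maxima over the grid stays bounded. *)
Require Import Defs.
From HB Require Import structures.
From mathcomp Require Import all_boot all_order all_algebra.
From mathcomp Require Import all_classical all_reals all_analysis.
From mathcomp Require Import ring lra.
Import Order.TTheory GRing.Theory Num.Theory.
Local Open Scope classical_set_scope.
Local Open Scope ring_scope.

(* MathComp-Analysis has its own [edist], an extended distance. *)
Local Notation edist := Defs.edist.

(** * Inner product, Euclidean norm, and triangles satisfying the lambda-inequality *)

Section EuclideanSpace.
Context {R : realType} {d : nat}.
Implicit Types (u v w x y z : 'rV[R]_d) (a lam : R).

Definition dot u v : R := \sum_(i < d) u ord0 i * v ord0 i.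

Lemma dotC u v : dot u v = dot v u.
Proof. by apply: eq_bigr => i _; rewrite mulrC. Qed.

Lemma dotDl u v w : dot (u + v) w = dot u w + dot v w.
Proof. by rewrite -big_split; apply: eq_bigr => i _; rewrite !mxE mulrDl. Qed.

Lemma dotZl a u v : dot (a *: u) v = a * dot u v.
Proof. by rewrite big_distrr; apply: eq_bigr => i _; rewrite !mxE /= mulrA. Qed.

Lemma dotDr u v w : dot w (u + v) = dot w u + dot w v.
Proof. by rewrite ![dot w _]dotC dotDl. Qed.

Lemma dotZr a u v : dot u (a *: v) = a * dot u v.
Proof. by rewrite ![dot u _]dotC dotZl. Qed.

Lemma dotNl u v : dot (- u) v = - dot u v.
Proof. by rewrite -scaleN1r dotZl mulN1r. Qed.

Lemma dotNr u v : dot u (- v) = - dot u v.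
Proof. by rewrite dotC dotNl dotC. Qed.

Lemma dot0l u : dot 0 u = 0.
Proof. by rewrite -(scale0r (0 : 'rV[R]_d)) dotZl mul0r. Qed.

Lemma dot_suml (s : seq 'rV[R]_d) v :
  dot (\sum_(u <- s) u) v = \sum_(u <- s) dot u v.
Proof.
elim: s => [|u s IH]; first by rewrite !big_nil dot0l.
by rewrite !big_cons dotDl IH.
Qed.

Lemma dot_sumr (s : seq 'rV[R]_d) v :
  dot v (\sum_(u <- s) u) = \sum_(u <- s) dot v u.
Proof. by rewrite dotC dot_suml; apply: eq_bigr => u _; rewrite dotC. Qed.

Lemma dotvv_ge0 u : 0 <= dot u u.
Proof. by apply: sumr_ge0 => i _; rewrite -expr2 sqr_ge0. Qed.

Lemma enorm_ge0 u : 0 <= enorm u.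
Proof. exact: sqrtr_ge0. Qed.

Lemma sqr_enorm u : enorm u ^+ 2 = dot u u.
Proof.
rewrite sqr_sqrtr; first by apply: eq_bigr => i _; rewrite expr2.
by apply: sumr_ge0 => i _; rewrite sqr_ge0.
Qed.

Lemma coord_le_enorm u i : `|u ord0 i| <= enorm u.
Proof.
rewrite -[X in X <= _]sqrtr_sqr ler_wsqrtr // (bigD1 i) //= lerDl.
by apply: sumr_ge0 => j _; rewrite sqr_ge0.
Qed.

Lemma enorm0_eq0 u : enorm u = 0 -> u = 0.
Proof.
move=> u0; apply/rowP => i; apply/eqP; rewrite !mxE -normr_le0 -u0.
exact: coord_le_enorm.
Qed.

Lemma enormN u : enorm (- u) = enorm u.
Proof. by congr Num.sqrt; apply: eq_bigr => i _; rewrite mxE sqrrN. Qed.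

Lemma edistC x y : edist x y = edist y x.
Proof. by rewrite /edist -enormN opprB. Qed.

Lemma edist_ge0 x y : 0 <= edist x y.
Proof. exact: enorm_ge0. Qed.

(** Cauchy-Schwarz, from the squared norm of [enorm v *: u - enorm u *: v], which is a multiple of
    the difference of the two sides. *)
Lemma dot_le_enorm u v : dot u v <= enorm u * enorm v.
Proof.
have := dotvv_ge0 (enorm v *: u - enorm u *: v).
rewrite !(dotDl, dotDr, dotNl, dotNr, dotZl, dotZr) -!sqr_enorm (dotC v u).
have [u0|u0] := eqVneq (enorm u) 0.
  by rewrite (enorm0_eq0 _ u0) dot0l mulr_ge0 ?enorm_ge0.
have [v0|v0] := eqVneq (enorm v) 0.
  by rewrite (enorm0_eq0 _ v0) dotC dot0l mulr_ge0 ?enorm_ge0.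
have uv : 0 < enorm u * enorm v by rewrite mulr_gt0 // lt0r ?u0 ?v0 enorm_ge0.
move=> h; rewrite -(ler_pM2l uv).
by move: h; nra.
Qed.

Lemma enormD u v : enorm (u + v) <= enorm u + enorm v.
Proof.
rewrite -(@ler_pXn2r _ 2) ?nnegrE ?addr_ge0 ?enorm_ge0 //.
rewrite sqr_enorm !(dotDl, dotDr) -!sqr_enorm (dotC v u).
by have := dot_le_enorm u v; nra.
Qed.

Lemma edist_triangle x y z : edist x z <= edist x y + edist y z.
Proof. by rewrite /edist; have := enormD (x - y) (y - z); rewrite addrA subrK. Qed.

Lemma dot_le_coord u v a D : (forall i, `|u ord0 i| <= a) ->
  (forall i, `|v ord0 i| <= D) -> `|dot u v| <= d%:R * (a * D).
Proof.
move=> ua vD; apply: le_trans (ler_norm_sum _ _ _) _.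
rewrite -[X in X%:R]card_ord -sum1_card natr_sum mulr_suml.
by apply: ler_sum => i _; rewrite mul1r normrM ler_pM.
Qed.

(** Square the hypothesis and apply the law of cosines at [z]; the leftover term
    [(1 - lam ^+ 2) * c ^+ 2] is nonnegative. *)
Lemma lambda_triangle_dot x y z lam : -1 <= lam -> lam < 1 ->
  edist x y <= edist x z + lam * edist y z ->
  - lam * (edist x z * edist y z) <= dot (z - x) (z - y).
Proof.
move=> lam_ge lam_lt h.
have xy2 : edist x y ^+ 2 =
    edist x z ^+ 2 + edist y z ^+ 2 - 2 * dot (z - x) (z - y).
  rewrite !sqr_enorm !(dotDl, dotDr, dotNl, dotNr) (dotC y x) (dotC z x) (dotC z y).
  by ring.
have := edist_ge0 x y; have := edist_ge0 y z; have := edist_ge0 x z.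
move: xy2 h; set a := edist x y; set b := edist x z; set c := edist y z.
move=> xy2 h b0 c0 a0.
have : a ^+ 2 <= (b + lam * c) ^+ 2 by rewrite ler_pXn2r // nnegrE ?(le_trans a0).
have : 0 <= (1 - lam ^+ 2) * c ^+ 2 by rewrite mulr_ge0 ?sqr_ge0 //; nra.
by rewrite xy2; nra.
Qed.

(** Insert the hypothesis into |y - z| <= |x - y| + |x - z|. *)
Lemma lambda_triangle_dist x y z lam :
  edist x y <= edist x z + lam * edist y z ->
  (1 - lam) / 2 * edist y z <= edist x z.
Proof. by move=> h; have := edist_triangle y x z; rewrite (edistC y x); lra. Qed.

(** This confines an arc to a ball determined by its endpoints [x] and [z]. For [lam >= 0], bound |y
    - z| by |x - y| + |x - z|; for [lam < 0], |x - y| <= |x - z| and [1 - lam <= 2]. *)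
Lemma lambda_triangle_bound x y z lam : -1 <= lam -> lam < 1 ->
  edist x y <= edist x z + lam * edist y z ->
  edist x y <= 2 / (1 - lam) * edist x z.
Proof.
move=> lam_ge lam_lt h.
have tri := edist_triangle y x z; rewrite (edistC y x) in tri.
rewrite mulrAC ler_pdivlMr ?subr_gt0 //.
have := edist_ge0 x y; have := edist_ge0 x z; have := edist_ge0 y z.
by have [lam0|lam0] := lerP 0 lam; nra.
Qed.

(** * Sums of unit vectors with inner products bounded below *)

Lemma sqr_sum_le (f : 'I_d -> R) :
  (\sum_i f i) ^+ 2 <= d%:R * \sum_i f i ^+ 2.
Proof.
have [d0|d0] := posnP d.
  by rewrite !big1 ?expr0n ?mulr0 // => i; have := ltn_ord i; rewrite {2}d0.
have dR : 0 < d%:R :> R by rewrite ltr0n.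
set S := \sum_i f i; set Q := \sum_i f i ^+ 2.
have : 0 <= \sum_i (d%:R * f i - S) ^+ 2.
  by apply: sumr_ge0 => i _; rewrite sqr_ge0.
have -> : \sum_i (d%:R * f i - S) ^+ 2 = d%:R * (d%:R * Q - S ^+ 2).
  transitivity (\sum_i (d%:R ^+ 2 * f i ^+ 2 - 2 * d%:R * S * f i + S ^+ 2)).
    by apply: eq_bigr => i _; ring.
  rewrite big_split sumrB -!mulr_sumr sumr_const card_ord -mulr_natr -/S -/Q /=.
  by ring.
by rewrite pmulr_rge0 // subr_ge0.
Qed.

(* With [S = \sum_a a^T a], the double sum is the squared Frobenius norm of [S] and [size s] is its
   trace. *)
Lemma sum_sqr_dot_ge (s : seq 'rV[R]_d) : (forall u, u \in s -> dot u u = 1) ->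
  (size s)%:R ^+ 2 <= d%:R * \sum_(a <- s) \sum_(b <- s) dot a b ^+ 2.
Proof.
move=> s1.
pose S p q := \sum_(a <- s) a ord0 p * a ord0 q : R.
have -> : \sum_(a <- s) \sum_(b <- s) dot a b ^+ 2 = \sum_p \sum_q S p q ^+ 2.
  transitivity (\sum_(a <- s) \sum_(b <- s) \sum_p \sum_q
      (a ord0 p * a ord0 q) * (b ord0 p * b ord0 q)).
    apply: eq_bigr => a _; apply: eq_bigr => b _.
    rewrite expr2 /dot mulr_suml; apply: eq_bigr => p _.
    by rewrite mulr_sumr; apply: eq_bigr => q _; ring.
  under eq_bigr => a _ do rewrite exchange_big /=.
  rewrite exchange_big; apply: eq_bigr => p _ /=.
  under eq_bigr => a _ do rewrite exchange_big /=.
  rewrite exchange_big; apply: eq_bigr => q _ /=.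
  rewrite expr2 /S mulr_suml; apply: eq_bigr => a _.
  by rewrite mulr_sumr.
have -> : (size s)%:R = \sum_p S p p.
  rewrite exchange_big /= -sum1_size natr_sum big_seq [RHS]big_seq.
  by apply: eq_bigr => u us; rewrite -[RHS]/(dot u u) s1.
apply: le_trans (sqr_sum_le _) _; apply: ler_wpM2l => //.
apply: ler_sum => p _; rewrite (bigD1 p) //= lerDl.
by apply: sumr_ge0 => q _; rewrite sqr_ge0.
Qed.

(* For [g] in [[- lam, 1]] one has [g ^+ 2 <= (1 - lam) * g + lam]; sum this over all the inner
   products [g] and use the previous lemma. *)
Lemma obtuse_sum_ge lam (s : seq 'rV[R]_d) :
  (forall u, u \in s -> dot u u = 1) ->
  (forall u v, u \in s -> v \in s -> - lam <= dot u v) ->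
  (1 - d%:R * lam) * (size s)%:R ^+ 2 <=
    d%:R * (1 - lam) * dot (\sum_(u <- s) u) (\sum_(u <- s) u).
Proof.
move=> s1 sobt.
have n1 u : u \in s -> enorm u = 1.
  move=> us; apply/eqP; rewrite -sqrp_eq1 ?enorm_ge0 //.
  by rewrite sqr_enorm s1.
have le1 : \sum_(a <- s) \sum_(b <- s) dot a b ^+ 2 <=
    \sum_(a <- s) \sum_(b <- s) ((1 - lam) * dot a b + lam).
  rewrite big_seq [leRHS]big_seq; apply: ler_sum => a sa.
  rewrite big_seq [leRHS]big_seq; apply: ler_sum => b sb.
  have := sobt a b sa sb; have := dot_le_enorm a b.
  by rewrite !n1 // mulr1; nra.
have eq1 : \sum_(a <- s) \sum_(b <- s) ((1 - lam) * dot a b + lam) =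
    (1 - lam) * dot (\sum_(u <- s) u) (\sum_(u <- s) u) + lam * (size s)%:R ^+ 2.
  rewrite dot_suml mulr_sumr.
  have -> : lam * (size s)%:R ^+ 2 = \sum_(a <- s) (lam * (size s)%:R).
    by rewrite big_const_seq count_predT iter_addr_0 -[RHS]mulr_natr; ring.
  rewrite -big_split; apply: eq_bigr => a _ /=.
  rewrite big_split -mulr_sumr dot_sumr big_const_seq count_predT iter_addr_0.
  by rewrite -[lam *+ _]mulr_natr.
have := sum_sqr_dot_ge s s1; rewrite eq1 in le1.
have := ler_wpM2l (ler0n R d) le1; lra.
Qed.

End EuclideanSpace.

(** * A half-space containing all the unit vectors uniformly *)

Section CommonDirection.
Context {R : realType} (d : nat) (lam : R).
Hypotheses (d_gt0 : (0 < d)%N) (lam_ge : -1 <= lam) (lam_lt : lam < d%:R^-1).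

Lemma natr_dim_gt0 : 0 < d%:R :> R.
Proof. by rewrite ltr0n. Qed.

Lemma lam_lt1 : lam < 1.
Proof. by apply: lt_le_trans lam_lt _; rewrite invf_le1 ?ler1n ?natr_dim_gt0. Qed.

(** By [obtuse_sum_ge], the mean of unit vectors with inner products at least [- lam] has squared
    norm at least [2 * eta]; the factor 2 is the slack for the contradiction in
    [common_direction]. *)
Definition eta : R := (1 - d%:R * lam) / (2 * d%:R * (1 - lam)).

Lemma eta_gt0 : 0 < eta.
Proof.
have d0 := natr_dim_gt0; have l1 := lam_lt1.
rewrite divr_gt0 //; last by rewrite !mulr_gt0 ?subr_gt0.
by rewrite subr_gt0 mulrC -ltr_pdivlMr // mul1r.
Qed.

(* Perceptron argument: if no such [w] exists, one can keep adding unit vectors [u] having inner product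
   less than [eta] with the mean of the vectors added so far; the norm of the sum then grows too slowly
   for [obtuse_sum_ge]. *)
Lemma common_direction (P : set 'rV[R]_d) :
  (forall u, P u -> dot u u = 1) ->
  (forall u v, P u -> P v -> - lam <= dot u v) ->
  exists w : 'rV[R]_d, (forall i, `|w ord0 i| <= 1) /\
    forall u, P u -> eta <= dot w u.
Proof.
move=> P1 Pobt; apply: contrapT => nw.
have next (w : 'rV[R]_d) : (forall i, `|w ord0 i| <= 1) ->
    exists2 u, P u & dot w u < eta.
  move=> w1; apply: contrapT => nu; apply: nw; exists w; split=> // u Pu.
  by rewrite leNgt; apply/negP => wu; apply: nu; exists u.
have Pcoord u i : P u -> `|u ord0 i| <= 1.
  move=> Pu; apply: le_trans (coord_le_enorm _ _) _.
  have := P1 u Pu; rewrite -sqr_enorm => /eqP.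
  by rewrite sqrp_eq1 ?enorm_ge0 // => /eqP ->.
have coord_sum i (s : seq 'rV[R]_d) : (forall u, u \in s -> P u) ->
    `|(\sum_(u <- s) u) ord0 i| <= (size s)%:R.
  move=> sP; rewrite summxE; apply: le_trans (ler_norm_sum _ _ _) _.
  rewrite -sum1_size natr_sum big_seq [leRHS]big_seq.
  by apply: ler_sum => u /sP/Pcoord.
have slow n : exists s : seq 'rV[R]_d, [/\ size s = n, forall u, u \in s -> P u &
    dot (\sum_(u <- s) u) (\sum_(u <- s) u) <= n%:R + eta * n%:R ^+ 2].
  elim: n => [|n [s [sn sP sle]]].
    by exists [::]; split=> //; rewrite big_nil dot0l expr0n mulr0 addr0.
  set x := \sum_(u <- s) u in sle.
  (* At [n = 0] the mean is [0], since [0^-1 = 0]. *)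
  have [i|u Pu ulow] := next (n%:R^-1 *: x).
    rewrite mxE normrM normfV normr_nat.
    have [->|n0] := posnP n; first by rewrite invr0 mul0r.
    by rewrite mulrC ler_pdivrMr ?ltr0n // mul1r -sn coord_sum.
  have xn : x = n%:R *: (n%:R^-1 *: x).
    have [n0|n0] := posnP n; last first.
      by rewrite scalerA mulfV ?scale1r // pnatr_eq0 -lt0n.
    by rewrite n0 scale0r /x; move: sn; rewrite n0 => /size0nil ->; rewrite big_nil.
  exists (u :: s); split=> [|v|]; first by rewrite /= sn.
    by rewrite inE => /predU1P[->//|/sP].
  (* The squared norm grows by 2 x.u + 1 <= 2 eta n + 1, and eta n^2 + 2 eta n <= eta (n + 1)^2. *)
  rewrite big_cons -/x !(dotDl, dotDr) P1 // (dotC u x).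
  have : dot x u <= n%:R * eta by rewrite xn dotZl ler_wpM2l // ltW.
  by have := eta_gt0; rewrite -natr1; nra.
(* The squared norm of the sum is at least 2 eta n^2 by [obtuse_sum_ge], and at most n + eta n^2 by
   [slow]. *)
have bound n : eta * n%:R <= 1 :> R.
  have [->|n0] := posnP n; first by rewrite mulr0 ler01.
  have [s [sn sP sle]] := slow n.
  have := obtuse_sum_ge lam s (fun u us => P1 u (sP u us))
    (fun u v us vs => Pobt u v (sP u us) (sP v vs)).
  have -> : 1 - d%:R * lam = d%:R * (1 - lam) * (2 * eta).
    by rewrite /eta; field; rewrite subr_eq0 gt_eqF ?lam_lt1 // gt_eqF ?natr_dim_gt0.
  move: sle; move: eta => e sle.
  rewrite sn -!mulrA ler_pM2l ?natr_dim_gt0 // ler_pM2l ?subr_gt0 ?lam_lt1 //.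
  move=> h; have nR : 0 < n%:R :> R by rewrite ltr0n.
  by rewrite -(ler_pM2r nR); nra.
have [n etan] : exists n : nat, eta^-1 < n%:R.
  by exists (Num.bound eta^-1); apply: archi_boundP; rewrite invr_ge0 ltW ?eta_gt0.
have := bound n; rewrite leNgt => /negP; apply.
by rewrite mulrC -ltr_pdivrMr ?eta_gt0 // mul1r.
Qed.

End CommonDirection.

(** * A finite grid of mesh [1 / K] in the cube [-1, 1]^d *)

Section Grid.
Context {R : realType} (d K : nat).
Hypothesis K_gt0 : (0 < K)%N.

Definition grid (f : {ffun 'I_d -> 'I_(2 * K).+1}) : 'rV[R]_d :=
  \row_i ((f i)%:R / K%:R - 1).

Lemma grid_le1 f i : `|grid f ord0 i| <= 1.
Proof.
have K0 : 0 < K%:R :> R by rewrite ltr0n.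
rewrite mxE ler_norml lerBrDr addNr divr_ge0 //= lerBlDr ler_pdivrMr //.
have := ltn_ord (f i); rewrite ltnS -(ler_nat R) natrM => h.
by apply: le_trans h _; lra.
Qed.

Lemma grid_approx (w : 'rV[R]_d) : (forall i, `|w ord0 i| <= 1) ->
  exists f, forall i, `|(grid f - w) ord0 i| <= K%:R^-1.
Proof.
move=> w1; have K0 : 0 < K%:R :> R by rewrite ltr0n.
(* Each coordinate is rounded down; the index is at most [2 * K], so [inord] keeps its value. *)
exists [ffun i => inord (Num.truncn (K%:R * (w ord0 i + 1)))] => i.
have := w1 i; rewrite ler_norml => /andP[wl wu].
have x0 : 0 <= K%:R * (w ord0 i + 1) by rewrite mulr_ge0 //; lra.
have /andP[tl tu] := truncn_itv x0.
rewrite !mxE ffunE inordK; last first.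
  rewrite ltnS -(ler_nat R) natrM; apply: le_trans tl _; nra.
move: tl tu; set t := Num.truncn _; rewrite -natr1 => tl tu.
have -> : t%:R / K%:R - 1 - w ord0 i = (t%:R - K%:R * (w ord0 i + 1)) / K%:R.
  by field; rewrite gt_eqF.
rewrite normrM normfV normr_nat ler_pdivrMr // mulVf ?gt_eqF //.
by rewrite ler_norml; apply/andP; split; lra.
Qed.

End Grid.

(** * Running maxima of a real sequence *)

Section RunningMax.
Context {R : realType} (f : nat -> R).

Fixpoint runmax (k : nat) : R :=
  if k is k'.+1 then Num.max (runmax k') (f k) else f 0%N.

Lemma runmax_le (k : nat) (B : R) : (forall i, (i <= k)%N -> f i <= B) -> runmax k <= B.
Proof.
elim: k => [|k IH] h /=; first exact: h.
by rewrite ge_max IH ?h // => i ik; rewrite h // ltnW.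
Qed.

Lemma runmax_mono k : runmax k <= runmax k.+1.
Proof. by rewrite le_max lexx. Qed.

Lemma runmax_jump (k : nat) (c : R) :
  (forall i, (i <= k)%N -> f i + c <= f k.+1) -> runmax k + c <= runmax k.+1.
Proof.
move=> h; apply: (@le_trans _ _ (f k.+1)); last by rewrite le_max lexx orbT.
by rewrite -lerBrDr; apply: runmax_le => i /h; rewrite -lerBrDr.
Qed.

End RunningMax.

(** * Length of a finite chain of points *)

Section LambdaChain.
Context {R : realType} (d : nat) (lam : R).
Hypotheses (d_gt0 : (0 < d)%N) (lam_ge : -1 <= lam) (lam_lt : lam < d%:R^-1).

Definition lambda_chain (m : nat) (p : nat -> 'rV[R]_d) : Prop :=
  forall i j k, (i <= j)%N -> (j <= k)%N -> (k <= m)%N ->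
    edist (p i) (p j) <= edist (p i) (p k) + lam * edist (p j) (p k).

(** Rounding the common direction to the grid costs at most [d / K <= eta / 2], leaving [eta / 2];
    the distance bound contributes the other factor [(1 - lam) / 2]. *)
Lemma chain_direction (K m : nat) (p : nat -> 'rV[R]_d) (k : nat) :
  (0 < K)%N -> d%:R / K%:R <= eta d lam / 2 -> lambda_chain m p -> (k < m)%N ->
  exists f, forall i, (i <= k)%N ->
    dot (grid d K f) (p i) + eta d lam * (1 - lam) / 4 * edist (p k) (p k.+1) <=
    dot (grid d K f) (p k.+1).
Proof.
move=> K0 Keta chain km; have l1 := lam_lt1 d lam d_gt0 lam_lt.
have e0 := eta_gt0 d lam d_gt0 lam_lt.
set z := p k.+1.
pose dz i := edist (p i) z.
(* Points equal to [z] give no direction and are treated separately in [zi]. *)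
pose P := [set u | exists i, [/\ (i <= k)%N, 0 < dz i & u = (dz i)^-1 *: (z - p i)]].
have P1 u : P u -> dot u u = 1.
  move=> [i [_ di ->]]; rewrite dotZl dotZr -sqr_enorm -/(edist z (p i)) edistC.
  by rewrite -/(dz i); field; rewrite gt_eqF.
have Pobt u v : P u -> P v -> - lam <= dot u v.
  move=> [i [ik di ->]] [j [jk dj ->]]; rewrite dotZl dotZr mulrA -invfM mulrC.
  rewrite ler_pdivlMr ?mulr_gt0 //.
  wlog ij : i j ik jk di dj / (i <= j)%N.
    move=> H; have [/H|/ltnW/H] := leqP i j; first exact.
    by rewrite dotC (mulrC (dz i)); exact.
  by apply: lambda_triangle_dot => //; apply: chain => //; rewrite ltnW.
have [w [w1 wP]] := common_direction d lam d_gt0 lam_lt P P1 Pobt.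
have [f fw] := grid_approx d K K0 w w1.
exists f => i ik.
have tri := chain i k k.+1 ik (leqnSn k) km.
have far := lambda_triangle_dist _ _ _ _ tri.
have zi : eta d lam / 2 * dz i <= dot (grid d K f) (z - p i).
  have [di|di] := ltP 0 (dz i); last first.
    have di0 : dz i = 0 by apply/eqP; rewrite eq_le di edist_ge0.
    have zpi : z - p i = 0 by apply: enorm0_eq0; rewrite -/(edist z (p i)) edistC.
    by rewrite di0 mulr0 zpi dotC dot0l.
  set u := (dz i)^-1 *: (z - p i).
  have Pu : P u by exists i.
  have ucoord j : `|u ord0 j| <= 1.
    apply: le_trans (coord_le_enorm _ _) _.
    have := P1 u Pu; rewrite -sqr_enorm => /eqP.
    by rewrite sqrp_eq1 ?enorm_ge0 // => /eqP ->.
  have err := dot_le_coord _ _ _ _ fw ucoord.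
  have wu := wP u Pu.
  have fu : eta d lam / 2 <= dot (grid d K f) u.
    move: err; rewrite mulr1 dotDl dotNl => err.
    have := le_trans err Keta; rewrite ler_norml => /andP[+ _]; lra.
  have -> : z - p i = dz i *: u by rewrite scalerA mulfV ?scale1r // gt_eqF.
  by rewrite dotZr mulrC ler_wpM2l // ltW.
have := ler_wpM2l (ltW e0) far.
by move: zi; rewrite dotDr dotNr /dz; lra.
Qed.

(** The constant [C] is uniform in [m], so the estimate survives the supremum over all polygons. *)
Lemma lambda_chain_length : exists C : R, forall m (p : nat -> 'rV[R]_d) (D : R),
  lambda_chain m p -> (forall i, (i <= m)%N -> edist (p i) (p 0%N) <= D) ->
  \sum_(i < m) edist (p i) (p i.+1) <= C * D.
Proof.
have l1 := lam_lt1 d lam d_gt0 lam_lt.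
have e0 := eta_gt0 d lam d_gt0 lam_lt.
pose K := (Num.bound (2 * d%:R / eta d lam)).+1.
have K0 : (0 < K)%N by [].
have Keta : d%:R / K%:R <= eta d lam / 2.
  have x0 : 0 <= 2 * d%:R / eta d lam.
    by apply: divr_ge0; [rewrite mulr_ge0 ?ler0n | exact: ltW].
  have KR : 0 < K%:R :> R by rewrite ltr0n.
  have := archi_boundP x0; rewrite ltr_pdivrMr // => h.
  have : (Num.bound (2 * d%:R / eta d lam))%:R <= K%:R :> R by rewrite ler_nat.
  by rewrite ler_pdivrMr //; nra.
pose G := {ffun 'I_d -> 'I_(2 * K).+1}.
pose c := eta d lam * (1 - lam) / 4.
have c0 : 0 < c by rewrite divr_gt0 // mulr_gt0 // subr_gt0.
exists (c^-1 * (#|G|%:R * d%:R)) => m p D chain pD.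
pose M (f : G) k := runmax (fun i => dot (grid d K f) (p i)) k.
(* The good direction [f] varies with [k]; summing over the whole grid absorbs this, as no running
   maximum decreases. *)
have step k : (k < m)%N -> c * edist (p k) (p k.+1) <= \sum_f (M f k.+1 - M f k).
  move=> km; have [f hf] := chain_direction K m p k K0 Keta chain km.
  rewrite (bigD1 f) //= -[leLHS]addr0 lerD //.
    by rewrite lerBrDl; apply: runmax_jump.
  by apply: sumr_ge0 => g _; rewrite subr_ge0 runmax_mono.
have top f : M f m - M f 0%N <= d%:R * D.
  rewrite lerBlDr; apply: runmax_le => i im.
  rewrite -lerBlDr -dotNr -dotDr; apply: le_trans (ler_norm _) _.
  have := dot_le_coord (grid d K f) (p i - p 0%N) 1 D (grid_le1 d K K0 f).
  rewrite mul1r; apply=> j; apply: le_trans (coord_le_enorm _ _) _; exact: pD.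
rewrite -mulrA ler_pdivlMl // mulr_sumr.
(* After exchanging the sums, each grid point telescopes to at most [d * D] by [top]. *)
apply: (@le_trans _ _ (\sum_(k < m) \sum_f (M f k.+1 - M f k))).
  by apply: ler_sum => k _; apply: step.
rewrite exchange_big /= -mulrA.
rewrite mulr_natl -sumr_const; apply: ler_sum => f _.
by rewrite -(big_mkord xpredT (fun k => M f k.+1 - M f k)) telescope_sumr.
Qed.

End LambdaChain.

(** * From chains to curves *)

Lemma bounded_lambda_curve_length (R : realType) (d : nat) (lam : R) (I : set R)
    (gamma : R -> 'rV[R]_d) :
  (1 <= d)%N -> -1 <= lam -> lam < d%:R^-1 -> lambda_curve lam I gamma ->
  bounded_image I gamma -> (curve_length I gamma < +oo)%E.
Proof.
move=> d0 lam_ge lam_lt curve [M hM].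
have [C hC] := lambda_chain_length d lam d0 lam_ge lam_lt.
apply: (@le_lt_trans _ _ (C * (M + M))%:E); last exact: ltry.
apply: ge_ereal_sup => _ [m [t [tI [tS ->]]]].
rewrite lee_fin; apply: (hC m (gamma \o t)).
  have mono i j : (i <= j)%N -> (j <= m)%N -> t i <= t j.
    move=> /subnK <-; elim: (j - i)%N => [//|n IH] nm.
    by apply: le_trans (IH (ltnW nm)) _; apply/ltW/tS.
  move=> i j k ij jk km; have jm := leq_trans jk km.
  apply: curve; [exact/tI/(leq_trans ij) | exact: tI | exact: tI | exact: mono | exact: mono].
move=> i im; apply: le_trans (enormD _ _) _.
by rewrite enormN; apply: lerD; apply: hM; exact: tI.
Qed.

Theorem theorem3p5 (R : realType) (d : nat) (lam : R) (I : set R)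
    (gamma : R -> 'rV[R]_d) :
  (1 <= d)%N -> -1 <= lam -> lam < (d%:R)^-1 ->
  is_interval I -> continuous_on_E I gamma -> lambda_curve lam I gamma ->
  rectifiable I gamma /\
  (bounded_image I gamma -> (curve_length I gamma < +oo)%E).
Proof.
move=> d0 lam_ge lam_lt _ _ curve; split; last exact: (@bounded_lambda_curve_length _ _ lam).
move=> a b Ia Ib; apply: (@bounded_lambda_curve_length _ _ lam) => //.
  by move=> t1 t2 t3 [I1 _] [I2 _] [I3 _]; exact: curve.
(* The arc over [a, b] is bounded by its endpoints, through [lambda_triangle_bound]. *)
exists (2 / (1 - lam) * edist (gamma a) (gamma b) + enorm (gamma a)).
move=> t [It /andP[a_t t_b]].
have := enormD (gamma t - gamma a) (gamma a); rewrite subrK => /le_trans; apply.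
rewrite lerD2r -/(edist _ _) edistC.
apply: lambda_triangle_bound => //; first exact: (lam_lt1 d).
exact: curve.
Qed.
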